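(* Let $(X_n)_{n\in\mathbb{N}}$ be a Markov chain on a finite state space $S$ with transition probability matrix $P$, and let $G=(S,E)$ and $\Phi:\mathbb{N}\times\mathcal{P}(S)\to\mathcal{P}(S)$ be its associated graph and semiflow. For a subset $C\subset S$ the following are equivalent: (1) $C$ is a communicating class of the graph $G$; (2) $C$ is a nontrivial communicating class of the Markov chain; (3) $C$ is a Morse set of the finest Morse decomposition of the semiflow $\Phi$.
   Context: Markov chains are time-homogeneous; $p_n(i,j)$ is the $n$-step transition probability, i.e. the $(i,j)$ entry of $P^n$ ($P^0=I$), and $p=p_1$. The associated graph $G=(S,E)$ has $(i,j)\in E$ iff $p(i,j)>0$ (every vertex then has an outgoing edge). The associated semiflow is $\Phi(n,A)=\{j\in S:\text{there is } i\in A\text{ with }p_n(i,j)>0\}$. Graph communicating classes: write $i\sim j$ if there are directed paths of length $\ge 1$ in $G$ from $i$ to $j$ and from $j$ to $i$; let $V_c=\{i\in S:i\sim j \text{ for some } j\in S\}$; the communicating classes of $G$ are the sets $[i]=\{j\in S: j\sim i\}$, $i\in V_c$. Markov chain communicating classes: $i$ and $j$ communicate via the chain if $p_n(i,j)>0$ and $p_m(j,i)>0$ for some $n,m\ge 0$; this is an equivalence relation and its classes are the communicating classes of the chain. A class is trivial if it is of the form $\{i\}$ with $p_n(i,i)=0$ for all $n\ge1$, and nontrivial otherwise. Morse decompositions: $\omega(A)=\{y\in S:\text{ there are }t_k\to\infty\text{ with }y\in\Phi(t_k,A)\}$. $A$ is weakly invariant if $\Phi(n,A)\cap A\ne\varnothing$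 for all $n\in\mathbb{N}=\{0,1,\dots\}$. The recurrent set is $\mathcal{R}=\{i\in S: i\in\Phi(n_l,\{i\})\text{ for some sequence } n_l\to\infty\}$. A finite collection $\mathcal{A}\subset\mathcal{P}(S)$ satisfies the no-cycle condition if for any $l\ge1$ and any members $A_{j_0},\dots,A_{j_l}$ of $\mathcal{A}$, not all equal, with $\omega(A_{j_\alpha})\cap A_{j_{\alpha+1}}\neq\varnothing$ for $\alpha=0,\dots,l-1$, one has $A_{j_0}\ne A_{j_l}$. A Morse decomposition is a finite collection of nonempty, pairwise disjoint, weakly invariant sets (Morse sets) whose union contains $\mathcal{R}$ and which satisfies the no-cycle condition. It is finer than another one if each of its elements is contained in some element of the other; the finest Morse decomposition is the one finer than every Morse decomposition (it exists and is unique). *)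

(* Defs.v *)
From HB Require Import structures.
From mathcomp Require Import all_boot all_order all_algebra.
From mathcomp Require Import all_classical all_reals all_analysis.

Set Implicit Arguments.
Unset Strict Implicit.
Unset Printing Implicit Defensive.

Import Order.TTheory GRing.Theory Num.Theory.
Import numFieldNormedType.Exports.

Local Open Scope classical_set_scope.
Local Open Scope ring_scope.

(* Transition matrices on a finite state space [S] are library matrices of
   size [#|S|]; states are turned into row/column indices by [enum_rank]. *)
Definition trans_prob (R : realType) (S : finType) (P : 'M[R]_#|S|)
    (n : nat) (i j : S) : R :=
  (P ^+ n) (enum_rank i) (enum_rank j).

Definition stochastic (R : realType) (S : finType) (P : 'M[R]_#|S|) : Prop :=
  (forall i j : S, 0 <= trans_prob P 1 i j) /\
  (forall i : S, \sum_(j : S) trans_prob P 1 i j = 1).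

(* [X] is a time-homogeneous Markov chain with transition matrix [P]. [S]
   carries the discrete sigma-algebra. The Markov property is
     mu (X_(n+1) = s_(n+1) | X_0 = s_0, ..., X_n = s_n) = p(s_n, s_(n+1))
   with the denominator of the conditional probability cleared; when the
   conditioning event is null the equation is automatically true. *)
Definition markov_chain (R : realType) (d : measure_display)
    (T : measurableType d) (mu : probability T R) (S : finType)
    (P : 'M[R]_#|S|) (X : nat -> T -> S) : Prop :=
  (forall (n : nat) (A : set S), measurable (X n @^-1` A)) /\
  (forall (n : nat) (s : nat -> S),
     mu [set w | forall k : nat, (k <= n.+1)%N -> X k w = s k] =
     (mu [set w | forall k : nat, (k <= n)%N -> X k w = s k] *
      (trans_prob P 1 (s n) (s n.+1))%:E)%E).

Definition graph_of (R : realType) (S : finType) (P : 'M[R]_#|S|) : rel S :=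
  fun i j => 0 < trans_prob P 1 i j.

Definition semiflow_of (R : realType) (S : finType) (P : 'M[R]_#|S|)
    (n : nat) (A : set S) : set S :=
  [set j | exists2 i, A i & 0 < trans_prob P n i j].

Section GraphClasses.
Variables (S : finType) (e : rel S).

(* A path from [i] is [i :: q]; its length is the number of edges, [size q]. *)
Definition has_path (i j : S) : Prop :=
  exists q : seq S, [/\ (1 <= size q)%N, path e i q & last i q = j].

Definition graph_comm (i j : S) : Prop := has_path i j /\ has_path j i.

Definition graph_Vc : set S := [set i | exists j, graph_comm i j].

Definition graph_comm_class (C : set S) : Prop :=
  exists2 i, graph_Vc i & C = [set j | graph_comm j i].

End GraphClasses.

Section ChainClasses.
Variables (R : realType) (S : finType) (P : 'M[R]_#|S|).

Definition chain_comm (i j : S) : Prop :=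
  exists n m : nat, 0 < trans_prob P n i j /\ 0 < trans_prob P m j i.

Definition chain_comm_class (C : set S) : Prop :=
  exists i, C = [set j | chain_comm i j].

Definition trivial_class (C : set S) : Prop :=
  exists i, C = [set i] /\
            forall n : nat, (1 <= n)%N -> trans_prob P n i i = 0.

Definition nontrivial_chain_comm_class (C : set S) : Prop :=
  chain_comm_class C /\ ~ trivial_class C.

End ChainClasses.

Section Morse.
Variables (S : finType) (Phi : nat -> set S -> set S).

Definition omega_limit (A : set S) : set S :=
  [set y | exists t : nat -> nat,
     t @ \oo --> \oo /\ forall k : nat, Phi (t k) A y].

Definition weakly_invariant (A : set S) : Prop :=
  forall n : nat, Phi n A `&` A !=set0.

Definition recurrent_set : set S :=
  [set i | exists t : nat -> nat,
     t @ \oo --> \oo /\ forall l : nat, Phi (t l) [set i] i].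

(* Only the values [A 0, ..., A l] of the sequence [A] matter. *)
Definition no_cycle (M : set (set S)) : Prop :=
  forall (l : nat) (A : nat -> set S), (1 <= l)%N ->
    (forall a : nat, (a <= l)%N -> M (A a)) ->
    ~ (forall a b : nat, (a <= l)%N -> (b <= l)%N -> A a = A b) ->
    (forall a : nat, (a < l)%N -> omega_limit (A a) `&` A a.+1 !=set0) ->
    A 0%N <> A l.

Definition morse_decomposition (M : set (set S)) : Prop :=
  [/\ finite_set M,
      (forall A, M A -> A !=set0 /\ weakly_invariant A),
      (forall A B, M A -> M B -> A <> B -> A `&` B = set0),
      recurrent_set `<=` \bigcup_(A in M) A
    & no_cycle M].

Definition finer (M M' : set (set S)) : Prop :=
  forall A, M A -> exists2 B, M' B & A `<=` B.

Definition finest_morse_decomposition (M : set (set S)) : Prop :=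
  morse_decomposition M /\
  forall M' : set (set S), morse_decomposition M' -> finer M M'.

End Morse.

(* Main.v *)
Require Import Defs.
From HB Require Import structures.
From mathcomp Require Import all_boot all_order all_algebra.
From mathcomp Require Import all_classical all_reals all_analysis.

(** Since [P] has nonnegative entries, [p_n(i,j) > 0] iff the graph has a path
    of length [n] from [i] to [j]. A state lies in a graph class iff it returns
    to itself with positive probability, and repeating its return loop shows
    that it is then recurrent. Hence any Morse decomposition covers each graph
    class, and by the no-cycle condition cannot split it: the graph classes form
    the finest Morse decomposition, and two decompositions finer than each other
    coincide. *)

Set Implicit Arguments.
Unset Strict Implicit.
Unset Printing Implicit Defensive.

Import Order.TTheory GRing.Theory Num.Theory.

Local Open Scope classical_set_scope.
Local Open Scope ring_scope.

Lemma cvg_nat_ge_id (t : nat -> nat) :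
  (forall k, (k <= t k)%N) -> t @ \oo --> \oo.
Proof.
move=> tge; apply/cvgnyPge => A.
by exists A => // n /= An; exact: leq_trans An (tge n).
Qed.

Lemma cvg_nat_pos (t : nat -> nat) :
  t @ \oo --> \oo -> exists k, (0 < t k)%N.
Proof.
move=> /cvgnyPge /(_ 1%N) [N _ tN].
by exists N; apply: (tN N) => /=.
Qed.

(** * Morse decompositions of an arbitrary family of set maps *)

Section MorseGeneral.
Variables (S : finType) (Phi : nat -> set S -> set S).

(** Refining in both directions gives [C] inside some [D] of [M'], and [D] inside some [C'] of [M].
    Members of [M] are nonempty and pairwise disjoint, so [C = C'] and [D] is squeezed between equal
    sets. *)
Lemma finest_morse_decomposition_subset (M M' : set (set S)) :
  finest_morse_decomposition Phi M -> finest_morse_decomposition Phi M' ->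
  M `<=` M'.
Proof.
move=> [mM fM] [mM' fM'] C MC.
have [D M'D CD] := fM _ mM' _ MC.
have [C' MC' DC'] := fM' _ mM _ M'D.
case: mM => _ neM disjM _ _.
suff CC' : C = C' by have -> : C = D by apply/seteqP; split=> //; rewrite CC'.
apply: contrapT => nCC'.
have [[x Cx] _] := neM _ MC.
have : (C `&` C') x by split=> //; exact/DC'/CD.
by rewrite (disjM _ _ MC MC' nCC').
Qed.

(** If [A] and [B] differed, the sequence [A], [B], [A] would be a forbidden cycle of length 2. *)
Lemma no_cycle_pair (M : set (set S)) (A B : set S) :
  no_cycle Phi M -> M A -> M B ->
  omega_limit Phi A `&` B !=set0 -> omega_limit Phi B `&` A !=set0 -> A = B.
Proof.
move=> ncM MA MB AB BA; apply: contrapT => nAB.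
apply: (ncM 2%N (fun a => if a == 1%N then B else A)) => //.
- by move=> a _; case: ifP.
- by move=> /(_ 0%N 1%N isT isT).
- by case=> [|[|]].
Qed.

End MorseGeneral.

(** * Positivity of the n-step transition probabilities *)

Section Chain.
Variables (R : realType) (S : finType) (P : 'M[R]_#|S|).
Hypothesis P_ge0 : forall i j : S, 0 <= trans_prob P 1 i j.

Lemma trans_prob0 i j : trans_prob P 0 i j = (i == j)%:R.
Proof. by rewrite /trans_prob expr0 mxE (inj_eq enum_rank_inj). Qed.

(** Chapman-Kolmogorov, with the matrix-index sum reindexed over states. *)
Lemma trans_probD n m i j :
  trans_prob P (n + m) i j = \sum_k trans_prob P n i k * trans_prob P m k j.
Proof.
rewrite /trans_prob exprD mxE (reindex (@enum_rank S)) //=.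
exact: onW_bij (enum_rank_bij S).
Qed.

Lemma trans_prob_ge0 n i j : 0 <= trans_prob P n i j.
Proof.
elim: n i j => [|n IHn] i j; first by rewrite trans_prob0 ler0n.
by rewrite -addn1 trans_probD sumr_ge0 // => k _; rewrite mulr_ge0.
Qed.

(** A sum of nonnegative terms is positive exactly when one of its terms is. *)
Lemma trans_probD_gt0P n m i j :
  (0 < trans_prob P (n + m) i j) <->
  exists k, 0 < trans_prob P n i k /\ 0 < trans_prob P m k j.
Proof.
have gt0E l x y : (0 < trans_prob P l x y) = (trans_prob P l x y != 0).
  by rewrite lt0r trans_prob_ge0 andbT.
split=> [|[k [ik kj]]].
  rewrite gt0E trans_probD psumr_neq0 => [/hasP[k _ /=]|k _]; last first.
    by rewrite mulr_ge0 ?trans_prob_ge0.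
  rewrite lt0r mulf_eq0 negb_or => /andP[/andP[ik kj] _].
  by exists k; rewrite !gt0E.
rewrite trans_probD (bigD1 k) //= ltr_pwDl ?mulr_gt0 //.
by rewrite sumr_ge0 // => l _; rewrite mulr_ge0 ?trans_prob_ge0.
Qed.

Lemma trans_prob_gt0_trans n m i k j :
  0 < trans_prob P n i k -> 0 < trans_prob P m k j ->
  0 < trans_prob P (n + m) i j.
Proof. by move=> ik kj; apply/trans_probD_gt0P; exists k. Qed.

Lemma trans_prob_gt0_loop n m i :
  0 < trans_prob P n i i -> 0 < trans_prob P (m * n) i i.
Proof.
move=> ii; elim: m => [|m IHm]; first by rewrite mul0n trans_prob0 eqxx ltr01.
by rewrite mulSn; exact: trans_prob_gt0_trans ii IHm.
Qed.

Lemma trans_prob_gt0_pathP n i j :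
  (0 < trans_prob P n i j) <->
  exists q, [/\ size q = n, path (graph_of P) i q & last i q = j].
Proof.
elim: n i => [|n IHn] i.
  rewrite trans_prob0; split=> [|[q [/size0nil-> _ /= ->]]]; last by rewrite eqxx ltr01.
  by have [-> _|_] := eqVneq i j; [exists [::] | rewrite ltxx].
rewrite -add1n; split.
  move=> /trans_probD_gt0P[k [ik /IHn[q [sq pq lq]]]].
  by exists (k :: q); rewrite /= sq pq andbT.
move=> [[|k q] [] //= [sq] /andP[ik pq] lq].
by apply: trans_prob_gt0_trans ik _; apply/IHn; exists q.
Qed.

(** * Graph classes and chain classes *)

Lemma has_pathP i j :
  has_path (graph_of P) i j <-> exists2 n, (0 < n)%N & 0 < trans_prob P n i j.
Proof.
split=> [[q [sq pq lq]]|[n n0 /trans_prob_gt0_pathP[q [sq pq lq]]]].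
  by exists (size q) => //; apply/trans_prob_gt0_pathP; exists q.
by exists q; rewrite sq.
Qed.

Lemma has_path_trans j i k :
  has_path (graph_of P) i j -> has_path (graph_of P) j k ->
  has_path (graph_of P) i k.
Proof.
move=> /has_pathP[n n0 ij] /has_pathP[m _ jk]; apply/has_pathP.
by exists (n + m)%N; [rewrite addn_gt0 n0 | exact: trans_prob_gt0_trans ij jk].
Qed.

Lemma graph_comm_sym i j :
  graph_comm (graph_of P) i j -> graph_comm (graph_of P) j i.
Proof. by case. Qed.

Lemma graph_comm_trans j i k :
  graph_comm (graph_of P) i j -> graph_comm (graph_of P) j k ->
  graph_comm (graph_of P) i k.
Proof.
by move=> [ij ji] [jk kj]; split; [exact: has_path_trans jk
  | exact: has_path_trans ji].
Qed.

Lemma graph_VcP i : graph_Vc (graph_of P) i <-> has_path (graph_of P) i i.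
Proof.
by split=> [[j [ij ji]]|ii]; [exact: has_path_trans ji | exists i].
Qed.

(** Chain communication allows zero steps, while graph paths need at least one. Inserting a return
    loop at [i] makes both connections of positive length. *)
Lemma graph_comm_chain_comm i j : graph_Vc (graph_of P) i ->
  graph_comm (graph_of P) j i <-> chain_comm P i j.
Proof.
move=> /graph_VcP/has_pathP[a a0 ii]; split.
  by move=> [/has_pathP[n _ ji] /has_pathP[m _ ij]]; exists m, n.
move=> [n [m [ij ji]]]; split; apply/has_pathP.
  by exists (m + a)%N; [rewrite addn_gt0 a0 orbT
    | exact: trans_prob_gt0_trans ji ii].
by exists (a + n)%N; [rewrite addn_gt0 a0 | exact: trans_prob_gt0_trans ii ij].
Qed.

Lemma graph_comm_class_chainP (C : set S) :
  graph_comm_class (graph_of P) C <-> nontrivial_chain_comm_class P C.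
Proof.
split=> [[i Vi ->]|[[i ->] ntriv]].
  split; first by exists i; apply/seteqP; split=> j /graph_comm_chain_comm; exact.
  have /graph_VcP ii := Vi.
  move=> [k [Ck pk0]]; have : [set k] i by rewrite -Ck.
  move=> /= ik; have /has_pathP[n n0] := ii.
  by rewrite ik (pk0 _ n0) ltxx.
have Vi : graph_Vc (graph_of P) i.
  (* Without a return path to [i], its chain class would be the trivial class [[set i]]. *)
  apply/graph_VcP; apply: contrapT => nii; apply: ntriv.
  have ret0 n : (0 < n)%N -> ~ 0 < trans_prob P n i i.
    by move=> n0 pn; apply/nii/has_pathP; exists n.
  exists i; split; last first.
    move=> n n0; apply/eqP; apply: contrapT => /negP pn.
    by apply: (ret0 n n0); rewrite lt0r pn trans_prob_ge0.
  apply/seteqP; split=> [j [n [m [ij ji]]]|_ ->] /=; last first.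
    by exists 0%N, 0%N; rewrite trans_prob0 eqxx ltr01.
  (* Going to [j] in a positive number of steps and back would be a return to [i]; hence zero steps
     were made and [j = i]. *)
  case: n ij => [|n] ij; last first.
    by case: (ret0 (n.+1 + m)%N) => //; exact: trans_prob_gt0_trans ij ji.
  by move: ij; rewrite trans_prob0; case: eqVneq => // _; rewrite ltxx.
by exists i => //; apply/seteqP; split=> j /graph_comm_chain_comm; exact.
Qed.

(** * Limit sets and recurrence in terms of paths *)

Lemma omega_limit_has_path (A : set S) y :
  omega_limit (semiflow_of P) A y ->
  exists2 x, A x & has_path (graph_of P) x y.
Proof.
move=> [t [/cvg_nat_pos[k tk0] /(_ k)[x Ax xy]]].
by exists x => //; apply/has_pathP; exists (t k).
Qed.

(** Running [k] times round a loop of length [a] at [x] before going to [y] gives arrival times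
    [k * a + n], which tend to infinity since [a > 0]. *)
Lemma loop_has_path_omega_limit (A : set S) x y :
  A x -> has_path (graph_of P) x x -> has_path (graph_of P) x y ->
  omega_limit (semiflow_of P) A y.
Proof.
move=> Ax /has_pathP[a a0 xx] /has_pathP[n _ xy].
exists (fun k => k * a + n)%N; split=> [|k].
  by apply: cvg_nat_ge_id => k; rewrite (leq_trans _ (leq_addr _ _)) ?leq_pmulr.
by exists x => //; apply: trans_prob_gt0_trans xy; exact: trans_prob_gt0_loop.
Qed.

Lemma recurrent_setP i :
  recurrent_set (semiflow_of P) i <-> has_path (graph_of P) i i.
Proof.
split=> [/omega_limit_has_path[_ ->]//|ii].
exact: (@loop_has_path_omega_limit [set i] i i).
Qed.

(** * The graph classes as the finest Morse decomposition *)

Lemma graph_comm_classE (C : set S) x : graph_comm_class (graph_of P) C ->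
  C x -> C = [set y | graph_comm (graph_of P) y x].
Proof.
move=> [i _ ->] /= xi; apply/seteqP; split=> y /= yi.
  exact: graph_comm_trans yi (graph_comm_sym xi).
exact: graph_comm_trans yi xi.
Qed.

Lemma graph_comm_class_has_path (C : set S) x y :
  graph_comm_class (graph_of P) C -> C x -> C y -> has_path (graph_of P) x y.
Proof. by move=> cC Cx; rewrite (graph_comm_classE cC Cx) => -[]. Qed.

Lemma graph_comm_class_weakly_invariant (C : set S) :
  graph_comm_class (graph_of P) C -> weakly_invariant (semiflow_of P) C.
Proof.
move=> [i /graph_VcP ii ->] n.
have /has_pathP[a a0 aii] := ii.
(* A loop of length [n * a], at least [n], is cut at time [n]: the state [k] visited then is reached
   from [i] and leads back to [i], so it lies in the class. *)
have : 0 < trans_prob P (n + (n * a - n)) i i.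
  by rewrite subnKC ?leq_pmulr //; exact: trans_prob_gt0_loop.
move=> /trans_probD_gt0P[k [ik ki]].
exists k; split; first by exists i.
have Vi : graph_Vc (graph_of P) i by apply/graph_VcP.
by apply/graph_comm_chain_comm => //; exists n, (n * a - n)%N.
Qed.

Lemma graph_comm_class_no_cycle :
  no_cycle (semiflow_of P) (graph_comm_class (graph_of P)).
Proof.
move=> l A l1 cA nconst step A0l; apply: nconst.
(* Successive limit-set intersections are chained into one path, using paths inside each class to
   join the end of one link to the start of the next. *)
have fwd b a : (a + b <= l)%N ->
    forall x y, A a x -> A (a + b)%N y -> has_path (graph_of P) x y.
  elim: b => [|b IHb].
    by rewrite addn0 => /cA cAa x y; exact: graph_comm_class_has_path.
  rewrite addnS => abl x y Ax Ay.
  have [z [/omega_limit_has_path[w Aw wz] Az]] := step _ abl.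
  apply: has_path_trans (IHb (ltnW abl) _ _ Ax Aw) _.
  apply: has_path_trans wz _.
  exact: graph_comm_class_has_path (cA _ abl) Az Ay.
suff all0 a : (a <= l)%N -> A a = A 0%N by move=> a b /all0-> /all0->.
move=> al.
have [i /graph_VcP ii A0E] := cA _ (leq0n l).
have [j /graph_VcP jj AaE] := cA _ al.
have A0i : A 0%N i by rewrite A0E.
have Aaj : A a j by rewrite AaE.
have ij : has_path (graph_of P) i j by exact: (fwd a 0%N).
(* Continuing from [A a] to [A l], which equals [A 0], closes the cycle. *)
have ji : has_path (graph_of P) j i.
  by apply: (fwd (l - a)%N a); rewrite ?subnKC // -A0l.
rewrite A0E; apply: graph_comm_classE (cA _ al) _.
by rewrite AaE; split.
Qed.

Lemma graph_comm_class_finest :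
  finest_morse_decomposition (semiflow_of P) (graph_comm_class (graph_of P)).
Proof.
split; first split.
- have -> : graph_comm_class (graph_of P) =
      (fun i => [set j | graph_comm (graph_of P) j i]) @` graph_Vc (graph_of P).
    by apply/seteqP; split=> C [i Vi CE]; exists i.
  exact/finite_image/finite_finset.
- move=> C cC; split; last exact: graph_comm_class_weakly_invariant.
  by have [i /graph_VcP ii ->] := cC; exists i.
- move=> A B cA cB nAB; apply/seteqP; split=> // x [Ax Bx]; apply: nAB.
  by rewrite (graph_comm_classE cA Ax) (graph_comm_classE cB Bx).
- move=> i /recurrent_setP ii.
  exists [set j | graph_comm (graph_of P) j i] => //.
  by exists i => //; apply/graph_VcP.
- exact: graph_comm_class_no_cycle.
move=> M [_ _ _ covM ncM] C cC.
have [i /graph_VcP ii CE] := cC.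
have Ci : C i by rewrite CE.
(* Each state of a class has a return path, so it is recurrent and covered by [M]. *)
have inM x : C x -> exists2 B, M B & B x.
  by move=> Cx; apply/covM/recurrent_setP/graph_comm_class_has_path; eassumption.
have [B MB Bi] := inM i Ci.
exists B => // j Cj; have [B' MB' B'j] := inM j Cj.
suff -> : B = B' by [].
have hp x y : C x -> C y -> has_path (graph_of P) x y.
  exact: graph_comm_class_has_path.
(* The loops at [i] and [j], followed by paths between them, put [j] in the limit set of [B] and [i]
   in that of [B']. *)
apply: no_cycle_pair ncM MB MB' _ _.
  by exists j; split=> //; apply: loop_has_path_omega_limit Bi _ _; exact: hp.
by exists i; split=> //; apply: loop_has_path_omega_limit B'j _ _; exact: hp.
Qed.

End Chain.

Theorem fact8 (R : realType) (S : finType)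
    (d : measure_display) (T : measurableType d) (mu : probability T R)
    (P : 'M[R]_#|S|) (X : nat -> T -> S)
    (hP : stochastic P) (hX : markov_chain mu P X) (C : set S) :
  [<-> graph_comm_class (graph_of P) C;
       nontrivial_chain_comm_class P C;
       exists M : set (set S),
         finest_morse_decomposition (semiflow_of P) M /\ M C].
Proof.
have [P_ge0 _] := hP; tfae.
- by move/(graph_comm_class_chainP P_ge0).
- move=> /(graph_comm_class_chainP P_ge0) cC.
  by exists (graph_comm_class (graph_of P)); split=> //;
    exact: graph_comm_class_finest.
- move=> [M [fM MC]].
  exact: (finest_morse_decomposition_subset fM (graph_comm_class_finest P_ge0)).
Qed.
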